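(* Let $\mathcal{F}=(\mathcal{F}_1,\ldots,\mathcal{F}_n,\ldots)$ be a sequence of increasing families with $\mathcal{F}_n\subseteq\mathcal{M}_n$ for each $n$. Define $t=t(n)=\min\{r\mid P_r(\mathcal{F}_n(r))\ge 1/2\}$. Then $t$ is a threshold for $\mathcal{F}$, i.e. for every function $\omega=\omega(n)\to\infty$ we have $P_{t\omega}(\mathcal{F}_n(t\omega))\to 1$ and $P_{t/\omega}(\mathcal{F}_n(t/\omega))\to 0$ as $n\to\infty$.
   Context: $\mathcal{M}_n$ is the poset of all (finite) multisets of $[n]=\{1,\ldots,n\}$ ordered by inclusion; $\mathcal{M}_n(r)$ is the set of $r$-element multisets, of cardinality $\binom{n+r-1}{r}$. For $\mathcal{F}_n\subseteq\mathcal{M}_n$, $\mathcal{F}_n(r)=\mathcal{F}_n\cap\mathcal{M}_n(r)$, and $P_r(\mathcal{F}_n(r))=|\mathcal{F}_n(r)|/\binom{n+r-1}{r}$ is the probability that a uniformly random $r$-multiset of $[n]$ lies in $\mathcal{F}_n$. A family $\mathcal{F}_n$ is increasing if $E\supseteq F\in\mathcal{F}_n$ implies $E\in\mathcal{F}_n$. Non-integer values $t\omega$, $t/\omega$ are interpreted as the nearest integer.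
   Formalization: The formal theorem additionally assumes that F_n is not all of M_n for all sufficiently large n; if F_n = M_n for infinitely many n, then t(n) = 0 and P_{t/ω} = P_0 = 1 for those n, so the second limit fails. *)

(* Defs.v *)
From HB Require Import structures.
From mathcomp Require Import all_boot all_order all_algebra.
From mathcomp Require Import finmap multiset.
From mathcomp Require Import all_classical all_reals all_analysis.

Set Implicit Arguments.
Unset Strict Implicit.
Unset Printing Implicit Defensive.

Import Order.TTheory GRing.Theory Num.Theory.
Import numFieldNormedType.Exports.

Local Open Scope classical_set_scope.
Local Open Scope ring_scope.

(* The ground set {1, ..., n} is represented by 'I_n. *)
Notation "''Mset_' n" := {mset 'I_n}%mset (at level 8, n at level 2) : type_scope.

Definition increasing n (F : set 'Mset_n) : Prop :=
  forall A B : 'Mset_n, F A -> (A `<=` B)%mset -> F B.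

Definition level n (F : set 'Mset_n) (r : nat) : set 'Mset_n :=
  [set A | F A /\ size A = r].

(* fset_set sends every infinite set to fset0; levels are finite. *)
Lemma finite_level n (F : set 'Mset_n) (r : nat) : finite_set (level F r).
Proof.
apply: (@sub_finite_set _ _ [set seq_mset (tval t) | t in [set: r.-tuple 'I_n]]).
  by move=> A /= [_ /eqP sA]; exists (Tuple sA) => //=; exact: seq_mset_id.
exact/finite_image/finite_finset.
Qed.

(* 'C(n + r - 1, r) is the number of r-element multisets of [n]. For n = 0 and
   r > 0 there are none, and the quotient is then 0 by convention. *)
Definition prob (R : realType) n (r : nat) (G : set 'Mset_n) : R :=
  (#|` fset_set G|)%:R / 'C(n + r - 1, r)%:R.

Definition is_min (S : set nat) (m : nat) : Prop :=
  S m /\ forall r, S r -> (m <= r)%N.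

(* Nearest natural number, halves being rounded up; 0 for negative x. *)
Definition nearest (R : realType) (x : R) : nat := Num.truncn (x + 2^-1).

Definition threshold (R : realType) (F : forall n, set 'Mset_n) (t : nat -> nat)
    : Prop :=
  forall omega : nat -> R, omega n @[n --> \oo] --> +oo ->
    let up n := nearest ((t n)%:R * omega n) in
    let down n := nearest ((t n)%:R / omega n) in
    (prob R (up n) (level (F n) (up n)) @[n --> \oo] --> (1 : R)) /\
    (prob R (down n) (level (F n) (down n)) @[n --> \oo] --> (0 : R)).

(* Main.v *)
Require Import Defs.
From mathcomp Require Import all_boot all_order all_algebra.
From mathcomp Require Import finmap multiset.
From mathcomp Require Import all_classical all_reals all_analysis.
From mathcomp Require Import ring lra zify.

(* Toss independent coins of bias x, a row of K + 1 for each i in [n], and let the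
   multiplicity of i be the length of the initial run of heads in row i.
   Conditionally on its size r <= K this random multiset is uniform, and membership
   in an increasing family is a monotone event of the coins, of probability Q(x).
   Taking the union, resp. the intersection, of two independent coin families gives
     1 - Q(1 - (1 - x)^2) <= (1 - Q(x))^2   and   Q(x^2) <= Q(x)^2.
   For x = l / (1 + l) the mean size is about n l. The first inequality for l <= 1 and
   the second for l >= 1 show that tripling l changes Q by at least Q (1 - Q) / 2, so Q
   has a coarse threshold in l. Since P_r is nondecreasing in r and the size of the
   multiset is at most C n l, and at least n l / C, with probability bounded below,
   the threshold passes from Q to P_r. *)

Import Order.TTheory GRing.Theory Num.Theory.
Import numFieldNormedType.Exports.

Local Open Scope classical_set_scope.
Local Open Scope ring_scope.

(** * Monotone events under biased coins *)

Section Bernoulli.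
Context {R : realType} {C : finType}.
Implicit Types (x y : R) (S T : {ffun C -> bool}) (E : pred {ffun C -> bool}).

Definition bern x (b : bool) : R := if b then x else 1 - x.

Definition pr x E : R := \sum_(S | E S) \prod_c bern x (S c).

Definition up_closed E :=
  forall S T, (forall c, S c -> T c) -> E S -> E T.

Lemma bern_sum x : \sum_b bern x b = 1.
Proof. by rewrite big_bool /= addrC subrK. Qed.

Lemma bern_ge0 x b : 0 <= x <= 1 -> 0 <= bern x b.
Proof. by case: b => /= /andP[x0 x1] //; rewrite subr_ge0. Qed.

Lemma weight_ge0 x S : 0 <= x <= 1 -> 0 <= \prod_c bern x (S c).
Proof. by move=> x01; apply: prodr_ge0 => c _; exact: bern_ge0. Qed.

Lemma pr_ge0 x E : 0 <= x <= 1 -> 0 <= pr x E.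
Proof. by move=> x01; apply: sumr_ge0 => S _; exact: weight_ge0. Qed.

Lemma pr_family x (D : C -> pred bool) :
  pr x (mem (family D)) = \prod_c \sum_(b | D c b) bern x b.
Proof. by rewrite bigA_distr_big_dep. Qed.

Lemma pr_predT x : pr x xpredT = 1.
Proof.
rewrite /pr -(bigA_distr_bigA (fun=> bern x))/= big1// => c _.
exact: bern_sum.
Qed.

Lemma eq_pr x E1 E2 : E1 =1 E2 -> pr x E1 = pr x E2.
Proof. by move=> E12; apply: eq_bigl. Qed.

Lemma le_pr x E1 E2 : 0 <= x <= 1 -> (forall S, E1 S -> E2 S) ->
  pr x E1 <= pr x E2.
Proof.
move=> x01 sub; rewrite /pr [leRHS](bigID E1)/=.
have E21 S : E2 S && E1 S = E1 S.
  by case: (boolP (E1 S)) => [/sub ->//|]; rewrite andbF.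
rewrite (eq_bigl _ _ E21).
by rewrite lerDl sumr_ge0// => S _; exact: weight_ge0.
Qed.

Lemma pr_split x E E1 : pr x E = pr x (predI E E1) + pr x (predI E (predC E1)).
Proof. exact: bigID. Qed.

Lemma prC x E : pr x (predC E) = 1 - pr x E.
Proof. by rewrite -(pr_predT x) (pr_split x xpredT E) addrC addKr. Qed.

Lemma pr_le1 x E : 0 <= x <= 1 -> pr x E <= 1.
Proof. by move=> x01; rewrite -(pr_predT x) le_pr. Qed.

Definition ffun2 (op : bool -> bool -> bool) S T : {ffun C -> bool} :=
  [ffun c => op (S c) (T c)].

(* Combining independent Bernoulli families coordinatewise again yields an
   independent Bernoulli family. *)
Lemma pr_ffun2 op x y z E :
    (forall b, \sum_b1 \sum_(b2 | op b1 b2 == b) bern x b1 * bern y b2 = bern z b) ->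
  pr z E = \sum_S \sum_(T | E (ffun2 op S T))
    (\prod_c bern x (S c)) * \prod_c bern y (T c).
Proof.
move=> opz.
have wz (U : {ffun C -> bool}) : \prod_c bern z (U c) =
    \sum_S \sum_(T | ffun2 op S T == U)
      (\prod_c bern x (S c)) * \prod_c bern y (T c).
  under eq_bigr => c _ do rewrite -opz.
  rewrite bigA_distr_bigA/=; apply: eq_bigr => S _.
  rewrite bigA_distr_big_dep/=; apply: eq_big => [T|T _]; last first.
    by rewrite big_split.
  apply/familyP/eqP => [h|<- c].
    by apply/ffunP => c; rewrite ffunE; apply/eqP; exact: h.
  by rewrite unfold_in ffunE eqxx.
rewrite /pr; under eq_bigr do rewrite wz.
rewrite exchange_big/=; apply: eq_bigr => S _.
rewrite (exchange_big_dep xpredT)//= [RHS]big_mkcond/=; apply: eq_bigr => T _.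
rewrite (eq_bigl (fun U : {ffun C -> bool} =>
  (U == ffun2 op S T) && E (ffun2 op S T))); last first.
  by move=> U; rewrite eq_sym andbC; case: eqVneq => //= <-.
case: ifP => h; last by rewrite big1// => U; rewrite andbF.
by under eq_bigl do rewrite andbT; rewrite big_pred1_eq.
Qed.

(** If [S] and [T] are independent with biases [x] and [y], their meet has bias [x * y], and a meet
    lying in an up-closed event forces both [S] and [T] into it. *)
Lemma pr_mul x y E : 0 <= x <= 1 -> 0 <= y <= 1 -> up_closed E ->
  pr (x * y) E <= pr x E * pr y E.
Proof.
move=> x01 y01 Emono; rewrite (pr_ffun2 andb x y); last first.
  by case; rewrite big_bool/= !(big_mkcond (fun b => _ b == _))/= !big_bool/=; ring.
rewrite /pr mulr_suml [leRHS]big_mkcond/=; apply: ler_sum => S _.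
case: (boolP (E S)) => ES.
  rewrite mulr_sumr [leRHS]big_mkcond [leLHS]big_mkcond/=; apply: ler_sum => T _.
  case: (boolP (E (ffun2 _ S T))) => EST; last first.
    by case: ifP => // _; rewrite mulr_ge0// weight_ge0.
  by rewrite (Emono _ T _ EST)// => c; rewrite ffunE => /andP[].
rewrite big1// => T EST; move: ES; rewrite (Emono _ S _ EST)// => c.
by rewrite ffunE => /andP[].
Qed.

End Bernoulli.

(** * Duality, monotonicity in the bias, and tripling of the odds *)

Lemma weight_neg {R : realType} {C : finType} (x : R) (S : {ffun C -> bool}) :
  \prod_c bern (1 - x) ([ffun c => ~~ S c] c) = \prod_c bern x (S c).
Proof. by apply: eq_bigr => c _; rewrite ffunE; case: (S c) => /=; ring. Qed.

Lemma pr_neg {R : realType} {C : finType} (x : R) (E : pred {ffun C -> bool}) :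
  pr (1 - x) E = pr x (fun S => E [ffun c => ~~ S c]).
Proof.
rewrite /pr (reindex_inj (h := fun S : {ffun C -> bool} => [ffun c => ~~ S c])).
  by apply: eq_bigr => S _; rewrite weight_neg.
move=> S T /ffunP h; apply/ffunP => c; move: (h c); rewrite !ffunE.
exact: negb_inj.
Qed.

(** Flipping all coins exchanges union and intersection and turns the complement of [E] into the
    up-closed event [E'], so this is [pr_mul] for [E'] at bias [1 - x]. *)
Lemma pr_or {R : realType} {C : finType} (x : R) (E : pred {ffun C -> bool}) :
    0 <= x <= 1 -> up_closed E ->
  1 - pr (1 - (1 - x) ^+ 2) E <= (1 - pr x E) ^+ 2.
Proof.
move=> x01 Emono.
pose E' := fun S : {ffun C -> bool} => ~~ E [ffun c => ~~ S c].
have E'mono : up_closed E'.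
  move=> S T ST; apply: contra => ET; apply: Emono ET => c.
  by rewrite !ffunE; apply: contra => /ST.
have dual y : 1 - pr (1 - y) E = pr y E'.
  by rewrite pr_neg -prC; exact: eq_pr.
rewrite dual -[X in 1 - pr X E](subKr 1) dual expr2 [leRHS]expr2.
by apply: pr_mul => //; lra.
Qed.

(** Thinning: write [x] as [x / y * y], apply [pr_mul], and drop a factor that is at most 1. *)
Lemma le_pr_param {R : realType} {C : finType} (x y : R)
    (E : pred {ffun C -> bool}) :
  0 <= x -> x <= y -> y <= 1 -> up_closed E -> pr x E <= pr y E.
Proof.
move=> x0 xy y1 Emono; have [y0|y0] := eqVneq y 0.
  by rewrite (_ : x = y)//; lra.
have ygt0 : 0 < y by lra.
have xy01 : 0 <= x / y <= 1 by rewrite divr_ge0 ?ler_pdivrMr ?mul1r//; lra.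
have y01 : 0 <= y <= 1 by lra.
rewrite -(divfK y0 x) (le_trans (pr_mul _ _ _ xy01 y01 Emono))//.
by rewrite ler_piMl ?pr_ge0 ?pr_le1.
Qed.

(** The bias [x] with [x / (1 - x) = l]; an untruncated run of heads then has mean [l]. *)
Definition odds {R : realType} (l : R) : R := l / (1 + l).

Lemma odds01 {R : realType} (l : R) : 0 <= l -> 0 <= odds l <= 1.
Proof.
by move=> l0; rewrite divr_ge0 ?ler_pdivrMr ?mul1r//; lra.
Qed.

Lemma oddsC {R : realType} (l : R) : 0 <= l -> 1 - odds l = (1 + l)^-1.
Proof. by move=> l0; rewrite /odds; field; rewrite gt_eqF; lra. Qed.

(* For l <= 1, the union of two copies is dominated by odds 3l; for l >= 1, the
   intersection of two copies of odds 3l dominates odds l. *)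
Lemma pr_triple {R : realType} {C : finType} (l : R) (E : pred {ffun C -> bool}) :
    0 <= l -> up_closed E ->
  pr (odds l) E + pr (odds l) E * (1 - pr (odds l) E) / 2 <= pr (odds (3 * l)) E.
Proof.
move=> l0 Emono; set q := pr (odds l) E.
have l30 : 0 <= 3 * l by lra.
have x01 := odds01 _ l0; have y01 := odds01 _ l30.
have q0 : 0 <= q by exact: pr_ge0.
have q1 : q <= 1 by exact: pr_le1.
set y := odds (3 * l) in y01 *.
have [l1|l1] := leP l 1.
  (* In terms of complements this is [(1 + l) ^+ 2 <= 1 + 3 * l], which is where [l <= 1] enters. *)
  have h : 1 - (1 - odds l) ^+ 2 <= y.
    rewrite /y -[odds (3 * l)](subKr 1) !oddsC// lerB//.
    rewrite exprVn lef_pV2 ?posrE ?exprn_gt0 ?expr2//; nra.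
  have h0 : 0 <= 1 - (1 - odds l) ^+ 2 by nra.
  have y1 : y <= 1 by lra.
  have := pr_or _ _ x01 Emono; rewrite -/q.
  have := le_pr_param _ _ E h0 h y1 Emono.
  set a := pr _ _; set b := pr _ _; nra.
have h : odds l <= y * y.
  rewrite -subr_ge0.
  have -> : y * y - odds l = l * (3 * l - 1) / ((1 + l) * (1 + 3 * l) ^+ 2).
    by rewrite /y /odds; field; rewrite !gt_eqF//; lra.
  by rewrite divr_ge0 ?mulr_ge0 ?exprn_ge0//; lra.
have yy1 : y * y <= 1 by nra.
have qb := le_pr_param _ _ E (andP x01).1 h yy1 Emono.
have ba := pr_mul _ _ _ y01 y01 Emono.
have a0 := pr_ge0 y E y01.
set a := pr y E in ba a0 *.
have qa : q <= a * a by exact: le_trans ba.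
(* As [q <= a * a], it suffices that the square of the claimed lower bound for [a] is at most [q];
   the difference factors explicitly below. *)
rewrite leNgt; apply/negP => ha.
have : a * a < (q + q * (1 - q) / 2) * (q + q * (1 - q) / 2) by nra.
have -> : (q + q * (1 - q) / 2) * (q + q * (1 - q) / 2) =
    q - q * (1 - q) ^+ 2 * (4 - q) / 4 by field.
have : 0 <= q * (1 - q) ^+ 2 * (4 - q) by rewrite !mulr_ge0 ?sqr_ge0//; lra.
lra.
Qed.

(** By [pr_triple], one tripling multiplies the failure probability by at most [1 - p / 2], which is
    at most 7/8 as long as [p] is at least 1/4. *)
Lemma pr_triple_up {R : realType} {C : finType} (l : R) (E : pred {ffun C -> bool})
    (j : nat) : 0 <= l -> up_closed E -> 4^-1 <= pr (odds l) E ->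
  1 - pr (odds (3 ^+ j * l)) E <= (7 / 8) ^+ j.
Proof.
move=> l0 Emono ql.
have lj i : 0 <= 3 ^+ i * l by rewrite mulr_ge0 ?exprn_ge0.
suff : 4^-1 <= pr (odds (3 ^+ j * l)) E /\
    1 - pr (odds (3 ^+ j * l)) E <= (7 / 8) ^+ j by case.
elim: j => [|j [IH1 IH2]]; first by rewrite expr0 mul1r; split => //; lra.
have := pr_triple _ _ (lj j) Emono.
have := pr_le1 _ E (odds01 _ (lj j)).
rewrite !exprS -(mulrA 3).
set p := pr (odds (3 ^+ j * l)) E in IH1 IH2 *.
set p' := pr _ _ => p1 pp'; split; nra.
Qed.

(** While [p <= 3 / 4], one tripling multiplies [p] by at least [1 + (1 - p) / 2], hence by at least
    9/8. The induction peels off the lowest tripling. *)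
Lemma pr_triple_down {R : realType} {C : finType} (l : R)
    (E : pred {ffun C -> bool}) (j : nat) :
  0 <= l -> up_closed E -> pr (odds (3 ^+ j * l)) E <= 3 / 4 ->
  pr (odds l) E <= (8 / 9) ^+ j.
Proof.
move=> + Emono; elim: j l => [|j IH] l l0; first by rewrite expr0 mul1r; lra.
rewrite exprSr -(mulrA _ 3) => pj.
have l30 : 0 <= 3 * l by lra.
have h := IH _ l30 pj.
have tr := pr_triple _ _ l0 Emono.
have l3j : odds (3 * l) <= odds (3 ^+ j * (3 * l)).
  rewrite -lerN2 -(lerD2l 1) !oddsC ?mulr_ge0 ?exprn_ge0//.
  rewrite lef_pV2 ?posrE; last 2 first.
  - by rewrite ltr_pwDl ?mulr_ge0 ?exprn_ge0.
  - by lra.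
  by rewrite lerD2l ler_peMl// exprn_ege1//; lra.
have /andP[x0 x1] := odds01 _ l30.
have /andP[z0 z1] : 0 <= odds (3 ^+ j * (3 * l)) <= 1.
  by apply: odds01; rewrite mulr_ge0 ?exprn_ge0.
have m3 := le_pr_param _ _ E x0 l3j z1 Emono.
have := pr_ge0 _ E (odds01 _ l0); have := pr_le1 _ E (odds01 _ l0).
rewrite exprS; set p := pr (odds l) E in tr *.
set p' := pr (odds (3 * l)) E in h tr m3 => p1 p0.
have p34 : p <= 3 / 4 by nra.
by nra.
Qed.

(** * Levels of increasing families of multisets *)

Definition levels {n} (F : set 'Mset_n) r : {fset 'Mset_n} := fset_set (level F r).

Lemma mem_levels {n} (F : set 'Mset_n) r (A : 'Mset_n) :
  (A \in levels F r) = `[< F A >] && (size A == r).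
Proof.
rewrite in_fset_set; last exact: finite_level.
apply/idP/andP => [/set_mem[FA <-]|[/asboolP FA /eqP sA]].
  by split=> //; exact/asboolP.
by rewrite mem_set.
Qed.

Lemma size_msetE {n} (A : 'Mset_n) : size A = (\sum_i A i)%N.
Proof.
rewrite -sum1_size (partition_big id xpredT)//=; apply: eq_bigr => i _.
by rewrite sum1_count -count_mem_mset; apply: eq_count => j; rewrite /= eq_sym.
Qed.

Lemma size_mset1D {n} (i : 'I_n) (A : 'Mset_n) : size (i +` A)%mset = (size A).+1.
Proof.
rewrite !size_msetE; under eq_bigr do rewrite mset1DE.
by rewrite big_split/= (bigD1 i)//= eqxx big1 ?addn0// => j /negPf ->.
Qed.

(** Adding one copy of [i] is injective, raises the multiplicity of [i] by one, and stays inside an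
    increasing family. *)
Lemma sum_levels_succ {n} (F : set 'Mset_n) r (i : 'I_n) : increasing F ->
  (\sum_(A <- levels F r) (A i).+1 =
   \sum_(B <- levels F r.+1 | B \in [seq i +` A | A <- levels F r]%mset) B i)%N.
Proof.
move=> Finc; rewrite -[RHS]big_filter.
transitivity (\sum_(B <- [seq (i +` A)%mset | A <- levels F r]) B i)%N.
  by rewrite big_map; apply: eq_bigr => A _; rewrite mset1DE eqxx.
apply: perm_big; apply: uniq_perm.
- rewrite map_inj_uniq ?fset_uniq// => A B AB.
  by rewrite -(msetD1K i A) AB msetD1K.
- exact/filter_uniq/fset_uniq.
move=> B; rewrite mem_filter andb_idr// => /mapP[A]; rewrite !mem_levels.
move=> /andP[/asboolP FA /eqP sA] ->; rewrite size_mset1D sA eqxx andbT.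
by apply/asboolP/(Finc A) => //; apply/msubsetP => j; rewrite mset1DE leq_addl.
Qed.

Lemma sum_levels_size {n} (F : set 'Mset_n) r c :
  (\sum_i \sum_(A <- levels F r) (A i + c) = (r + n * c) * #|` levels F r|)%N.
Proof.
rewrite exchange_big/= [LHS]big_seq (eq_bigr (fun=> r + n * c)%N).
  by rewrite -big_seq big_const_seq count_predT iter_addn_0.
move=> A; rewrite mem_levels => /andP[_ /eqP <-].
by rewrite big_split/= size_msetE sum_nat_const card_ord.
Qed.

(** Normalized matching by double counting: summing [sum_levels_succ] over [i], each [A] in level
    [r] contributes [n + r], and each [B] in level [r.+1] at most [r.+1]. *)
Lemma leq_levels_succ {n} (F : set 'Mset_n) r : increasing F ->
  ((n + r) * #|` levels F r| <= r.+1 * #|` levels F r.+1|)%N.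
Proof.
move=> Finc; have := sum_levels_size F r.+1 0; rewrite muln0 addn0 => <-.
rewrite addnC -[in (_ + n)%N](muln1 n) -sum_levels_size; apply: leq_sum => i _.
under eq_bigr do rewrite addn1.
rewrite sum_levels_succ// big_mkcond/=; apply: leq_sum => B _.
by rewrite addn0; case: ifP.
Qed.

(** In the full poset nothing is lost: a [B] outside the image of adding [i] has multiplicity 0 at
    [i]. *)
Lemma eq_levelsT_succ n r :
  ((n + r) * #|` levels [set: 'Mset_n] r| =
   r.+1 * #|` levels [set: 'Mset_n] r.+1|)%N.
Proof.
have := sum_levels_size [set: 'Mset_n] r.+1 0; rewrite muln0 addn0 => <-.
rewrite addnC -[in (_ + n)%N](muln1 n) -sum_levels_size; apply: eq_bigr => i _.
under eq_bigr do rewrite addn1; under [RHS]eq_bigr do rewrite addn0.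
rewrite sum_levels_succ// big_mkcond/= big_seq [RHS]big_seq; apply: eq_bigr => B.
rewrite mem_levels => /andP[_ /eqP sB]; case: ifPn => // /mapP h.
apply/esym/eqP; rewrite mset_eq0; apply/negP => iB; apply: h.
exists (B `\ i)%mset; last by rewrite msetB1K.
rewrite mem_levels; apply/andP; split; first exact/asboolP.
by rewrite -eqSS -(size_mset1D i) msetB1K// sB.
Qed.

Lemma card_levelsT n r : (0 < n)%N ->
  #|` levels [set: 'Mset_n] r| = 'C(n + r - 1, r).
Proof.
move=> n0; elim: r => [|r IH].
  rewrite bin0 (_ : levels _ _ = [fset mset0]%fset) ?cardfs1//.
  apply/fsetP => A; rewrite mem_levels inE size_mset_eq0.
  by apply: andb_idl => _; exact/asboolP.
apply/eqP; rewrite -(eqn_pmul2l (ltn0Sn r)) -eq_levelsT_succ IH.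
have -> : (n + r.+1 - 1 = (n + r - 1).+1)%N by lia.
by rewrite -mul_bin_diag; apply/eqP; congr muln; lia.
Qed.

Section Prob.
Context {R : realType} {n : nat}.
Hypothesis n0 : (0 < n)%N.
Implicit Types (F : set 'Mset_n) (r : nat).

Notation P F r := (prob R r (level F r)).

Lemma bin_gt0R r : 0 < 'C(n + r - 1, r)%:R :> R.
Proof. by rewrite ltr0n bin_gt0; lia. Qed.

Lemma prob_levels F r :
  P F r * 'C(n + r - 1, r)%:R = #|` levels F r|%:R.
Proof. by rewrite divfK// gt_eqF ?bin_gt0R. Qed.

Lemma prob_ge0 F r : 0 <= P F r.
Proof. by rewrite divr_ge0. Qed.

Lemma prob_le1 F r : P F r <= 1.
Proof.
rewrite ler_pdivrMr ?bin_gt0R// mul1r ler_nat -card_levelsT//.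
apply: fsubset_leq_card; apply/fsubsetP => A; rewrite !mem_levels => /andP[_ ->].
by rewrite andbT; exact/asboolP.
Qed.

Lemma prob_succ F r : increasing F -> P F r <= P F r.+1.
Proof.
move=> /(leq_levels_succ F r) h.
rewrite ler_pdivrMr ?bin_gt0R// mulrAC ler_pdivlMr ?bin_gt0R//.
have nr0 : (0 : R) < (n + r)%:R by rewrite ltr0n; lia.
rewrite -(ler_pM2l nr0) !mulrA -!natrM.
have -> : ((n + r) * #|` fset_set (level F r.+1)| * 'C(n + r - 1, r) =
   r.+1 * #|` fset_set (level F r.+1)| * 'C(n + r.+1 - 1, r.+1))%N.
  rewrite -!(mulnC #|`_|) -!mulnA; congr muln.
  have -> : (n + r.+1 - 1 = (n + r - 1).+1)%N by lia.
  by rewrite -mul_bin_diag; congr muln; lia.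
by rewrite ler_nat leq_mul2r h orbT.
Qed.

Lemma le_prob F : increasing F -> {homo (fun r => P F r) : r s / (r <= s)%N >-> r <= s}.
Proof.
by move=> Finc; apply: homo_leq => [//|? ? ?|r]; [exact: le_trans|exact: prob_succ].
Qed.

(** A proper increasing family misses the empty multiset, which lies below all others. This makes
    [t n] positive and settles the case where [t / omega] rounds to 0. *)
Lemma prob_0 F : increasing F -> F <> setT -> P F 0 = 0.
Proof.
move=> Finc FT; rewrite /prob (_ : fset_set _ = fset0) ?cardfs0 ?mul0r//.
apply/fsetP => A; rewrite -/(levels F 0) mem_levels size_mset_eq0 inE.
apply/negP => /andP[/asboolP FA /eqP A0]; apply: FT; apply/seteqP; split=> // B _.
by apply: Finc FA _; rewrite A0; exact: msub0set.
Qed.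

End Prob.

(** * Random multisets from runs of coins *)

Section Runs.
Context {R : realType} {n K : nat}.
Implicit Types (S T : {ffun 'I_n * 'I_K.+1 -> bool}) (A : 'Mset_n) (x : R).

(** A row without tails gives [K.+1], so the run is a geometric variable truncated at [K.+1]. *)
Definition run S (i : 'I_n) : nat :=
  find (fun k => ~~ S (i, inord k)) (iota 0 K.+1).

Definition runs S : 'Mset_n :=
  seq_mset (flatten [seq nseq (run S i) i | i <- enum 'I_n]).

Lemma runsE S i : runs S i = run S i.
Proof.
rewrite mset_seqE count_flatten -map_comp sumnE big_map big_enum/= (bigD1 i)//=.
rewrite count_nseq/= eqxx mul1n big1 ?addn0// => j ji.
by rewrite count_nseq/= (negPf ji).
Qed.

Lemma run_le S i : (run S i <= K.+1)%N.
Proof. by rewrite -[leqRHS](size_iota 0) find_size. Qed.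

Lemma run_gtP S i (k : 'I_K.+1) :
  reflect (forall l : 'I_K.+1, (l <= k)%N -> S (i, l)) (k < run S i)%N.
Proof.
apply: (iffP idP) => [kr l lk|h].
  have lr := leq_ltn_trans lk kr.
  by have /negbFE := before_find 0%N lr; rewrite nth_iota// add0n inord_val.
rewrite ltnNge; apply/negP => rk.
have rK := leq_ltn_trans rk (ltn_ord k).
have hs : has (fun k => ~~ S (i, inord k)) (iota 0 K.+1).
  by rewrite has_find size_iota.
have := nth_find 0%N hs; rewrite -/(run S i) nth_iota// add0n h//.
by rewrite inordK.
Qed.

(** One condition per coin, so that the probability will factor; [v <= K] ensures that the tail
    ending the run is among the coins of the row. *)
Lemma run_eq S i v : (v <= K)%N ->
  (run S i == v) = [forall k : 'I_K.+1,
     if (k < v)%N then S (i, k) else (k == v :> nat) ==> ~~ S (i, k)].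
Proof.
move=> vK; apply/eqP/forallP => [rv k|h].
  case: ltnP => kv; first by apply/(run_gtP S i k) => //; rewrite rv.
  apply/implyP => /eqP kv'; apply/negP => Sk.
  suff : (k < run S i)%N by rewrite rv kv' ltnn.
  apply/run_gtP => l; rewrite leq_eqVlt => /orP[/eqP/val_inj ->//|lk].
  by apply/(run_gtP S i l) => //; rewrite rv -kv'.
apply/eqP; rewrite eqn_leq; apply/andP; split.
  rewrite leqNgt; apply/negP => vr.
  have /run_gtP/(_ _ (leqnn _)) : (Ordinal (vK : v < K.+1)%N < run S i)%N by [].
  by have := h (Ordinal (vK : v < K.+1)%N); rewrite /= ltnn eqxx/= => /negPf ->.
case: v vK h => // v vK h.
have vK' : (v < K.+1)%N by lia.
apply/(run_gtP S i (Ordinal vK')) => l /= lv.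
by have := h l; rewrite ltnS lv.
Qed.

Lemma runs_monotone (F : set 'Mset_n) : increasing F ->
  up_closed (fun S => `[< F (runs S) >]).
Proof.
move=> Finc S T ST /asboolP FS; apply/asboolP/(Finc _ _ FS)/msubsetP => i.
rewrite !runsE; case E : (run S i) => [//|k].
have kK : (k < K.+1)%N by rewrite -E run_le.
apply/(run_gtP T i (Ordinal kK)) => l lk; apply: ST.
by apply/(run_gtP S i (Ordinal kK)) => //; rewrite E.
Qed.

Lemma geometric_prod x v : (v <= K)%N ->
  \prod_(k < K.+1) (if (k < v)%N then x else if k == v :> nat then 1 - x else 1) =
  x ^+ v * (1 - x).
Proof.
move=> vK; rewrite -(big_mkord xpredT (fun k => if (k < v)%N then x else
  if k == v :> nat then 1 - x else 1)).
rewrite (big_cat_nat (n := v))//=; last exact: leqW.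
rewrite (eq_big_nat _ _ (F2 := fun=> x)); last by move=> k /andP[_ ->].
rewrite prodr_const_nat subn0; congr (_ * _).
rewrite big_ltn// ltnn eqxx big_nat_cond big1 ?mulr1// => k /andP[/andP[vk _] _].
by rewrite ltnNge (ltnW vk)/= gtn_eqF.
Qed.

(** Row [i] contributes [x ^+ A i * (1 - x)]. The product depends on [A] only through its size,
    which is the conditional uniformity of [runs]. *)
Lemma pr_runs_eq x A : (size A <= K)%N ->
  pr x (fun S => runs S == A) = (1 - x) ^+ n * x ^+ size A.
Proof.
move=> sA; have AK i : (A i <= K)%N.
  by apply: leq_trans sA; rewrite size_msetE (bigD1 i)//= leq_addr.
pose D (c : 'I_n * 'I_K.+1) (b : bool) :=
  if (c.2 < A c.1)%N then b else (c.2 == A c.1 :> nat) ==> ~~ b.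
rewrite (@eq_pr _ _ _ _ (mem (family D))); last first.
  move=> S; apply/eqP/familyP => [SA [i k]|h].
    have /eqP : run S i = A i by rewrite -SA runsE.
    by rewrite run_eq// => /forallP/(_ k).
  apply/msetP => i; rewrite runsE; apply/eqP; rewrite run_eq//.
  by apply/forallP => k; exact: (h (i, k)).
rewrite pr_family -(pair_bigA _ (fun i k => \sum_(b | D (i, k) b) bern x b))/=.
under eq_bigr => i _.
  under eq_bigr => k _.
    rewrite (_ : \sum_(b | _) _ = if (k < A i)%N then x else
      if k == A i :> nat then 1 - x else 1); last first.
      rewrite big_mkcond big_bool /D/=.
      by case: ltnP => _; [rewrite addr0|case: eqP => _ /=; ring].
    over.
  rewrite geometric_prod//.
  over.
rewrite big_split/= prodr_const card_ord mulrC; congr (_ * _).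
by rewrite size_msetE prodrXr.
Qed.

Lemma pr_runs_level x (F : set 'Mset_n) r : (r <= K)%N ->
  pr x (fun S => `[< F (runs S) >] && (size (runs S) == r)) =
  #|` levels F r|%:R * ((1 - x) ^+ n * x ^+ r).
Proof.
move=> rK; transitivity (\sum_(A <- levels F r) pr x (fun S => runs S == A)).
  rewrite /pr (exchange_big_dep xpredT)//= big_mkcond/=; apply: eq_bigr => S _.
  rewrite -mem_levels; case: ifP => h.
    rewrite -[RHS]big_filter.
    rewrite (_ : [seq A <- levels F r | runs S == A] = [:: runs S]) ?big_seq1//.
    rewrite -[RHS](filter_pred1_uniq (fset_uniq (levels F r)))//.
    by apply: eq_filter => A; rewrite /= eq_sym.
  rewrite big_seq_cond big1// => A /andP[AF /eqP SA].
  by move: h; rewrite SA AF.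
rewrite [LHS]big_seq (eq_bigr (fun=> (1 - x) ^+ n * x ^+ r)); last first.
  by move=> A; rewrite mem_levels => /andP[_ /eqP sA]; rewrite pr_runs_eq sA.
by rewrite -big_seq big_const_seq count_predT iter_addr_0 mulr_natl.
Qed.

Lemma pr_range x (E : pred {ffun 'I_n * 'I_K.+1 -> bool}) (f : _ -> nat) a b :
  pr x (fun S => E S && (a <= f S < b)%N) =
  \sum_(r < b | (a <= r)%N) pr x (fun S => E S && (f S == r)).
Proof.
rewrite /pr (exchange_big_dep (fun S => E S && (a <= f S < b)%N))/=; last first.
  by move=> r S ar /andP[-> /eqP ->]; rewrite ar/=.
apply: eq_bigr => S /andP[ES /andP[af fb]].
rewrite (big_pred1 (Ordinal fb))// => r /=.
by rewrite ES/= eq_sym andb_idl// => /eqP ->.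
Qed.

Lemma pr_run_gt x i (k : 'I_K.+1) : pr x (fun S => k < run S i)%N = x ^+ k.+1.
Proof.
pose D (c : 'I_n * 'I_K.+1) (b : bool) := (c.1 == i) && (c.2 < k.+1)%N ==> b.
rewrite (@eq_pr _ _ _ _ (mem (family D))); last first.
  move=> S; apply/run_gtP/familyP => [h [j l]|h l lk].
    by rewrite unfold_in /D/=; apply/implyP => /andP[/eqP -> lk]; exact: h.
  by have := h (i, l); rewrite unfold_in /D/= eqxx ltnS lk.
rewrite pr_family (eq_bigr (fun c : _ * 'I_K.+1 => if (c.1 == i) && (c.2 < k.+1)%N
    then x else 1)); last first.
  move=> c _; rewrite big_mkcond big_bool /D.
  by case: (_ && _) => /=; ring.
rewrite -big_mkcond -(pair_big_dep (pred1 i)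
  (fun _ (l : 'I_K.+1) => (l < k.+1)%N) (fun _ _ => x))/= big_pred1_eq.
by rewrite (big_ord_narrow (ltn_ord k)) prodr_const card_ord.
Qed.

(** Markov's inequality. The mean size is the sum over rows of the tails [x ^+ k.+1], and a full
    geometric series would give exactly [l] per row. *)
Lemma markov_size (l : R) s : 0 <= l ->
  s%:R * pr (odds l) (fun S => s <= size (runs S))%N <= n%:R * l.
Proof.
move=> l0; have x01 := odds01 _ l0; set x := odds l in x01 *.
have xl : x = l * (1 - x) by rewrite /x oddsC.
apply: (@le_trans _ _ (\sum_(S : {ffun _ * 'I_K.+1 -> bool})
    (\prod_c bern x (S c)) * (size (runs S))%:R)).
  rewrite /pr mulr_sumr big_mkcond/=; apply: ler_sum => S _.
  case: ifP => [sS|_]; last by rewrite mulr_ge0 ?weight_ge0.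
  by rewrite mulrC ler_wpM2l ?weight_ge0// ler_nat.
have sumE : \sum_(S : {ffun _ * 'I_K.+1 -> bool})
    (\prod_c bern x (S c)) * (size (runs S))%:R =
    \sum_(i < n) \sum_(k < K.+1) pr x (fun S => k < run S i)%N.
  rewrite /pr; under [RHS]eq_bigr do rewrite (exchange_big_dep xpredT)//=.
  rewrite exchange_big/=; apply: eq_bigr => S _.
  rewrite size_msetE natr_sum mulr_sumr; apply: eq_bigr => i _.
  rewrite runsE (big_ord_narrow (run_le S i)).
  by rewrite sumr_const card_ord mulr_natr.
rewrite sumE; under eq_bigr do under eq_bigr do rewrite pr_run_gt exprS.
rewrite sumr_const card_ord -[leLHS]mulr_natl ler_wpM2l// -mulr_sumr.
have := subrX1 x K.+1; set g := \sum_(_ < _) _ => gE.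
have : 0 <= x ^+ K.+1 by rewrite exprn_ge0//; lra.
have h1 : (1 - x) * g <= 1 by have := exprn_ge0 K.+1 (andP x01).1; lra.
by move=> _; rewrite [in leLHS]xl; nra.
Qed.

(** * Comparison of coin probabilities with level probabilities *)

Section Sandwich.
Variable F : set 'Mset_n.
Hypotheses (n0 : (0 < n)%N) (Finc : increasing F).

Notation P r := (prob R r (level F r)).

Lemma pr_level x r : (r <= K)%N ->
  pr x (fun S => `[< F (runs S) >] && (size (runs S) == r)) =
  P r * pr x (fun S => size (runs S) == r).
Proof.
move=> rK; rewrite pr_runs_level// -(prob_levels n0) -mulrA; congr (_ * _).
rewrite -card_levelsT// -pr_runs_level//; apply: eq_pr => S.
by rewrite asboolT.
Qed.

(** On sizes at most [s] the conditional probability of [F] is at most [P s]; larger sizes are given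
    up. *)
Lemma pr_runs_le x s : 0 <= x <= 1 -> (s <= K)%N ->
  pr x (fun S => `[< F (runs S) >]) <=
  P s + pr x (fun S => s < size (runs S))%N.
Proof.
move=> x01 sK; rewrite (pr_split x _ (fun S => 0 <= size (runs S) < s.+1)%N).
apply: lerD; last by apply: le_pr => // S /= /andP[_]; rewrite -ltnNge.
rewrite (pr_range x (fun S => `[< F (runs S) >]) (fun S => size (runs S)))/=.
apply: (@le_trans _ _ (\sum_(r < s.+1) P s * pr x (fun S => size (runs S) == r))).
  apply: ler_sum => r _; rewrite pr_level; last by have := ltn_ord r; lia.
  by rewrite ler_wpM2r ?pr_ge0// le_prob// -ltnS.
rewrite -mulr_sumr -(pr_range x xpredT (fun S => size (runs S)) 0)/=.
by rewrite ler_piMr ?prob_ge0// pr_le1.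
Qed.

(** Only sizes from [u] to [K] are kept: there the conditional probability is at least [P u], while
    above [K] truncation spoils uniformity. *)
Lemma pr_runs_ge x u : 0 <= x <= 1 -> (u <= K)%N ->
  P u * (1 - pr x (fun S => size (runs S) < u)%N - pr x (fun S => K < size (runs S))%N)
  <= pr x (fun S => `[< F (runs S) >]).
Proof.
move=> x01 uK; pose N S := size (runs S).
apply: (@le_trans _ _ (P u * pr x (fun S => u <= N S < K.+1)%N)).
  rewrite ler_wpM2l ?prob_ge0//.
  rewrite -prC (pr_split x _ (fun S => N S < K.+1)%N) lerBlDr.
  by apply: lerD; apply: le_pr => // S /=; rewrite -leqNgt// => /andP[_];
    rewrite -leqNgt.
apply: (@le_trans _ _ (pr x (fun S => `[< F (runs S) >] && (u <= N S < K.+1)%N))).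
  rewrite (pr_range x xpredT N) pr_range mulr_sumr; apply: ler_sum => r ur.
  rewrite pr_level; last by rewrite -ltnS.
  by rewrite ler_wpM2r ?pr_ge0// le_prob.
by apply: le_pr => // S /andP[].
Qed.

End Sandwich.

(* Change of parameter: for r < u the weight (1 - x)^n x^r exceeds
   (1 - y)^n y^r by a factor of at most the right-hand side. *)
Lemma pr_size_lt x y u : 0 < y -> y <= x -> x < 1 -> (u <= K.+1)%N ->
  pr x (fun S => size (runs S) < u)%N <= (x / y) ^+ u * ((1 - x) / (1 - y)) ^+ n.
Proof.
move=> y0 yx x1 uK.
have sumE (z : R) : pr z (fun S => size (runs S) < u)%N =
    \sum_(r < u) #|` levels [set: 'Mset_n] r|%:R * ((1 - z) ^+ n * z ^+ r).
  transitivity (\sum_(r < u) pr z (fun S => size (runs S) == r)).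
    exact: (pr_range z xpredT (fun S => size (runs S)) 0).
  apply: eq_bigr => r _; rewrite -pr_runs_level; last by have := ltn_ord r; lia.
  by apply: eq_pr => S; rewrite asboolT.
set c := leRHS; have c0 : 0 <= c.
  by rewrite mulr_ge0 ?exprn_ge0 ?divr_ge0//; lra.
apply: (@le_trans _ _ (c * pr y (fun S => size (runs S) < u)%N)); last first.
  by rewrite ler_piMr// pr_le1//; lra.
rewrite !sumE mulr_sumr; apply: ler_sum => r _.
rewrite [leRHS]mulrCA ler_wpM2l// /c (expr_div_n (1 - x)).
have -> : (x / y) ^+ u * ((1 - x) ^+ n / (1 - y) ^+ n) * ((1 - y) ^+ n * y ^+ r) =
    (x / y) ^+ u * y ^+ r * (1 - x) ^+ n.
  set a := (x / y) ^+ u.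
  by field; rewrite expf_neq0// gt_eqF//; lra.
rewrite mulrC ler_wpM2r ?exprn_ge0//; first lra.
have -> : x ^+ r = (x / y) ^+ r * y ^+ r by rewrite -exprMn divfK// gt_eqF.
rewrite ler_wpM2r ?exprn_ge0//; first exact: ltW.
by rewrite ler_weXn2l ?ler_pdivlMr ?mul1r// ltnW.
Qed.

End Runs.

(** * The threshold *)

Section Bounds.
Context {R : realType} {n : nat}.
Hypothesis n16 : (16 <= n)%N.

(** A Chernoff-type lower tail: with [m = u / n], compare the odds [16 * m] with [8 * m] in
    [pr_size_lt]. The two factors are at most [expR (u * d)] and [expR (- (8 * u * d))]. *)
Lemma pr_size_lt_quarter {K} u : (0 < u)%N -> (u <= K.+1)%N ->
  pr (odds (16 * u%:R / n%:R) : R)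
    (fun S : {ffun 'I_n * 'I_K.+1 -> bool} => size (runs S) < u)%N <= 4^-1.
Proof.
move=> u0 uK; have n16R : 16 <= n%:R :> R by rewrite ler_nat.
have u1 : 1 <= u%:R :> R by rewrite ler1n.
have nn0 : (n%:R : R) != 0 by rewrite gt_eqF//; lra.
pose m : R := u%:R / n%:R.
have m0 : 0 < m by rewrite divr_gt0//; lra.
have mn : m * n%:R = u%:R by rewrite divfK.
rewrite -(mulrA 16) -/m.
have e0 : 1 + 16 * m != 0 by rewrite gt_eqF//; lra.
have e1 : 1 + 8 * m != 0 by rewrite gt_eqF//; lra.
have y0 : 0 < odds (8 * m) by rewrite divr_gt0//; lra.
have xy : odds (8 * m) <= odds (16 * m).
  rewrite -subr_ge0 (_ : _ - _ = 8 * m / ((1 + 16 * m) * (1 + 8 * m))).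
    by rewrite divr_ge0 ?mulr_ge0//; lra.
  by rewrite /odds; field; rewrite e0 e1.
have x1 : odds (16 * m) < 1 by rewrite ltr_pdivrMr; lra.
apply: (le_trans (pr_size_lt _ _ _ y0 xy x1 uK)).
pose d := (1 + 16 * m)^-1.
have d0 : 0 < d by rewrite invr_gt0; lra.
have dE : d * (1 + 16 * m) = 1 by rewrite mulVf.
have -> : odds (16 * m) / odds (8 * m) = 1 + d.
  by rewrite /odds /d; field; rewrite e0 e1 gt_eqF//.
have -> : (1 - odds (16 * m)) / (1 - odds (8 * m)) = 1 + - (8 * m * d).
  rewrite !oddsC; [|lra|lra].
  by rewrite /d; field; rewrite e0.
have h1 : (1 + d) ^+ u <= expR d ^+ u.
  by rewrite lerXn2r ?nnegrE ?expR_ge0 ?expR_ge1Dx//; lra.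
have h2 : (1 + - (8 * m * d)) ^+ n <= expR (- (8 * m * d)) ^+ n.
  rewrite lerXn2r ?nnegrE ?expR_ge0 ?expR_ge1Dx//; nra.
have h3 : 0 <= (1 + - (8 * m * d)) ^+ n by rewrite exprn_ge0//; nra.
have h4 : 0 <= (1 + d) ^+ u by rewrite exprn_ge0//; lra.
apply: (le_trans (ler_pM h4 h3 h1 h2)).
rewrite -!expRM_natl -expRD.
have -> : u%:R * d + n%:R * - (8 * m * d) = - (7 * (u%:R * d)).
  by rewrite -mn; ring.
(* Since [16 <= n], [16 * m <= u], so [u * d] is at least [u / (1 + u)]. Then [expR (7 * (u * d))]
   is at least [1 + 7 / 2], which exceeds 4. *)
have ud : 2^-1 <= u%:R * d.
  have : 16 * m <= u%:R by rewrite -mn mulrC ler_wpM2l//; lra.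
  nra.
rewrite expRN lef_pV2 ?posrE ?expR_gt0//.
by apply: le_trans (expR_ge1Dx _); lra.
Qed.

Variable F : set 'Mset_n.
Hypothesis Finc : increasing F.

Notation P r := (prob R r (level F r)).
Notation Q K l := (pr (odds l : R)
  (fun S : {ffun 'I_n * 'I_K.+1 -> bool} => `[< F (runs S) >])).

Let n0 : (0 < n)%N. Proof. exact: leq_trans n16. Qed.
Let nR0 : 0 < n%:R :> R. Proof. by rewrite ltr0n. Qed.

Lemma pr_size_gt K l s : 0 <= l ->
  pr (odds l : R) (fun S : {ffun 'I_n * 'I_K.+1 -> bool} => s < size (runs S))%N
  <= n%:R * l / s.+1%:R.
Proof. by move=> l0; rewrite ler_pdivlMr ?ltr0n// mulrC; exact: markov_size. Qed.

(** Sizes below [u] cost at most 1/4, and so do sizes above [K], by Markov with mean at most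
    [16 * u] against [64 * u]; half of [P u] survives. *)
Lemma half_prob_le K u : (0 < u)%N -> (64 * u <= K)%N ->
  P u / 2 <= Q K (16 * u%:R / n%:R).
Proof.
move=> u0 uK; have l0 : 0 <= 16 * u%:R / n%:R :> R by rewrite divr_ge0// mulr_ge0.
have uK' : (u <= K)%N by lia.
apply: le_trans (pr_runs_ge F n0 Finc _ _ (odds01 _ l0) uK').
have := pr_size_lt_quarter _ u0 (leqW uK').
have := pr_size_gt K _ K l0; set p1 := pr _ _; set p2 := pr _ _ => h1 h2.
have h3 : n%:R * (16 * u%:R / n%:R) / K.+1%:R <= 4^-1 :> R.
  rewrite mulrCA divff ?gt_eqF// mulr1 ler_pdivrMr ?ltr0n//.
  have : (64 * u)%:R <= K.+1%:R :> R by rewrite ler_nat leqW.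
  by rewrite natrM; lra.
by rewrite ler_wpM2l ?prob_ge0//; have := le_trans h1 h3; lra.
Qed.

(** At odds [16 * t / n] the coin probability is at least 1/4. After [j] triplings it misses 1 by at
    most [(7 / 8) ^+ j], and by Markov the size exceeds [s] with probability at most [1 / M]. *)
Lemma prob_up t s j M : (0 < t)%N -> (0 < M)%N -> 2^-1 <= P t ->
  (16 * 3 ^ j * t * M <= s)%N -> 1 - P s <= (7 / 8) ^+ j + M%:R^-1.
Proof.
move=> t0 M0 Pt sM; pose K := (s + 64 * t)%N.
have l0 : 0 <= 16 * t%:R / n%:R :> R by rewrite divr_ge0// mulr_ge0.
have l0j : 0 <= 3 ^+ j * (16 * t%:R / n%:R) :> R by rewrite mulr_ge0// exprn_ge0.
have q0 : 4^-1 <= Q K (16 * t%:R / n%:R).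
  have tK : (64 * t <= K)%N by rewrite /K; lia.
  by apply: le_trans (half_prob_le _ _ t0 tK); lra.
have := pr_triple_up _ _ j l0 (runs_monotone _ Finc) q0.
have := pr_runs_le F n0 Finc _ _ (odds01 _ l0j) (leq_addr _ _ : s <= K)%N.
suff h : n%:R * (3 ^+ j * (16 * t%:R / n%:R)) / s.+1%:R <= M%:R^-1 :> R.
  by have := le_trans (pr_size_gt K _ s l0j) h; lra.
rewrite ler_pdivrMr ?ltr0n// ler_pdivlMl ?ltr0n//.
have -> : M%:R * (n%:R * (3 ^+ j * (16 * t%:R / n%:R))) = (16 * 3 ^ j * t * M)%:R :> R.
  by rewrite !natrM natrX; field; rewrite gt_eqF.
by rewrite ler_nat leqW.
Qed.

(** The odds [16 * u / n] tripled [j] times still give mean size at most a quarter of [s.+1], so the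
    coin probability there is at most 1/2 + 1/4. Descending the [j] triplings bounds it at the
    original odds, and [P u] is at most twice that. *)
Lemma prob_down s u j : (0 < u)%N -> P s <= 2^-1 ->
  (64 * 3 ^ j * u <= s.+1)%N -> P u <= 2 * (8 / 9) ^+ j.
Proof.
move=> u0 Ps us; pose K := (s + 64 * u)%N.
have l0 : 0 <= 16 * u%:R / n%:R :> R by rewrite divr_ge0// mulr_ge0.
have l0j : 0 <= 3 ^+ j * (16 * u%:R / n%:R) :> R by rewrite mulr_ge0// exprn_ge0.
have Pu : P u / 2 <= Q K (16 * u%:R / n%:R).
  by apply: half_prob_le => //; rewrite /K; lia.
have hs := pr_runs_le F n0 Finc _ _ (odds01 _ l0j) (leq_addr _ _ : s <= K)%N.
have h3 : n%:R * (3 ^+ j * (16 * u%:R / n%:R)) / s.+1%:R <= 4^-1 :> R.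
  rewrite ler_pdivrMr ?ltr0n// ler_pdivlMl//.
  have -> : 4 * (n%:R * (3 ^+ j * (16 * u%:R / n%:R))) = (64 * 3 ^ j * u)%:R :> R.
    by rewrite !natrM natrX; field; rewrite gt_eqF.
  by rewrite ler_nat.
have qj : Q K (3 ^+ j * (16 * u%:R / n%:R)) <= 3 / 4.
  by have := le_trans (pr_size_gt K _ s l0j) h3; lra.
have := pr_triple_down _ _ j l0 (runs_monotone _ Finc) qj; lra.
Qed.

End Bounds.

(** * Passage to the limit *)

Lemma exists_expr_le {R : realType} (a e : R) : 0 <= a < 1 -> 0 < e ->
  exists j : nat, a ^+ j <= e.
Proof.
move=> /andP[a0 a1] e0; have /cvg_expr : `|a| < 1 by rewrite ger0_norm.
move=> /cvgrPdist_le/(_ e e0)[j _ /(_ j (leqnn j))/=].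
by rewrite sub0r normrN ger0_norm ?exprn_ge0//; exists j.
Qed.

Theorem theorem5 (R : realType) (F : forall n : nat, set 'Mset_n)
    (F_increasing : forall n : nat, (0 < n)%N -> increasing (F n))
    (F_proper : \forall n \near \oo, F n <> [set: 'Mset_n])
    (t : nat -> nat)
    (t_min : forall n : nat, (0 < n)%N ->
       is_min [set r | 2^-1 <= prob R r (level (F n) r)] (t n)) :
  threshold R F t.
Proof.
move=> omega /cvgryPge omega_oo up down.
split; apply/cvgrPdist_le => e e0.
  have [j je] : exists j : nat, (7 / 8 : R) ^+ j <= e / 2.
    by apply: exists_expr_le; lra.
  have [M M0 Me] : exists2 M : nat, (0 < M)%N & M%:R^-1 <= e / 2.
    exists (Num.truncn (2 / e)).+1 => //.
    rewrite -[leRHS]invrK lef_pV2 ?posrE ?invr_gt0 ?ltr0n//; last by lra.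
    by rewrite invf_div ltW// truncnS_gt.
  near=> n.
  have n16 : (16 <= n)%N by near: n; exact: nbhs_infty_ge.
  have n0 : (0 < n)%N by exact: leq_trans n16.
  have FT : F n <> [set: 'Mset_n] by near: n.
  have Finc := F_increasing n n0.
  have [/= tP _] := t_min n n0.
  have om : (16 * 3 ^ j * M)%:R <= omega n by near: n; exact: omega_oo.
  have t0 : (0 < t n)%N.
    by rewrite lt0n; apply/eqP => t0; move: tP; rewrite t0 prob_0//; lra.
  (* The lower bound is an integer, so rounding [t * omega] to the nearest integer cannot fall below
     it. *)
  have us : (16 * 3 ^ j * t n * M <= up n)%N.
    rewrite /up /nearest mulnAC truncn_ge_nat.
      rewrite mulnC natrM; have := ler_wpM2l (ler0n R (t n)) om; lra.
    have := mulr_ge0 (ler0n R (t n)) (le_trans (ler0n _ _) om); lra.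
  have := prob_up n16 _ Finc _ _ _ _ t0 M0 tP us.
  have := prob_le1 n0 (F n) (up n) (R := R).
  by move=> ? ?; rewrite ger0_norm; lra.
have [j je] : exists j : nat, (8 / 9 : R) ^+ j <= e / 2.
  by apply: exists_expr_le; lra.
near=> n.
have n16 : (16 <= n)%N by near: n; exact: nbhs_infty_ge.
have n0 : (0 < n)%N by exact: leq_trans n16.
have FT : F n <> [set: 'Mset_n] by near: n.
have Finc := F_increasing n n0.
have [/= tP tmin] := t_min n n0.
(* Twice the 64 of [prob_down]: when [down n] is at least 1, the rounding error 1/2 is at most half
   of it, so [down n / 2 <= t / omega]. *)
have om : (128 * 3 ^ j)%:R <= omega n by near: n; exact: omega_oo.
have om0 : 0 < omega n.
  by apply: lt_le_trans om; rewrite ltr0n muln_gt0 expn_gt0.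
have t0 : (0 < t n)%N.
  by rewrite lt0n; apply/eqP => t0; move: tP; rewrite t0 prob_0//; lra.
rewrite sub0r normrN ger0_norm ?prob_ge0//.
have [->|d0] := posnP (down n); first by rewrite prob_0// ltW.
have dle : (down n)%:R <= (t n)%:R / omega n + 2^-1.
  by rewrite /down /nearest truncn_le addr_ge0// divr_ge0// ltW.
have d1 : 1 <= (down n)%:R :> R by rewrite ler1n.
have dt : (64 * 3 ^ j * down n <= (t n).-1.+1)%N.
  rewrite prednK// -(ler_nat R).
  have h : (down n)%:R / 2 * omega n <= (t n)%:R by rewrite -ler_pdivlMr//; lra.
  apply: le_trans h; rewrite natrM mulrC.
  move: om; rewrite !natrM; nra.
(* The level just below [t n] plays the role of [s] in [prob_down]; minimality of [t n] bounds its
   probability. *)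
have tP' : prob R (t n).-1 (level (F n) (t n).-1) <= 2^-1.
  by rewrite leNgt; apply/negP => /ltW/tmin; lia.
have := prob_down n16 _ Finc _ _ _ d0 tP' dt; lra.
Unshelve. all: by end_near.
Qed.
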